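(* Let $n>t\ge 2$ be integers. If a $K_{t+2}$-minor-free graph $U$ contains every $n$-vertex graph of pathwidth at most $t$ as a subgraph, then $U$ has at least $2^{(n-t-4)/t}$ vertices.
   Context: ''$U$ contains $H$ as a subgraph'' means $U$ has a subgraph isomorphic to $H$. Pathwidth is the usual notion. *)

(* Defs.v *)
From HB Require Import structures.
From mathcomp Require Import all_boot all_order all_algebra.
From mathcomp Require Import boolp reals exp.

Set Implicit Arguments.
Unset Strict Implicit.
Unset Printing Implicit Defensive.

Record sgraph := SGraph {
  vertex :> finType;
  adj : rel vertex;
  adj_sym : symmetric adj;
  adj_irrefl : irreflexive adj }.

Definition isomorphic (G H : sgraph) : Prop :=
  exists2 f : G -> H, bijective f & {mono f : x y / adj x y}.

Record subgraph (G : sgraph) := Subgraph {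
  sub_vertex : {set G};
  sub_adj : rel G;
  sub_adj_sym : symmetric sub_adj;
  sub_adj_mem : forall x y, sub_adj x y -> (x \in sub_vertex) && (y \in sub_vertex);
  sub_adj_adj : subrel sub_adj (@adj G) }.

Section SubgraphGraph.
Variables (G : sgraph) (S : subgraph G).

Definition subgraph_adj : rel {x : G | x \in sub_vertex S} :=
  [rel x y | sub_adj S (val x) (val y)].

Lemma subgraph_adj_sym : symmetric subgraph_adj.
Proof. by move=> x y; apply: sub_adj_sym. Qed.

Lemma subgraph_adj_irrefl : irreflexive subgraph_adj.
Proof.
by move=> x; apply/negP => /(@sub_adj_adj G S); rewrite adj_irrefl.
Qed.

Definition sgraph_of_subgraph : sgraph :=
  SGraph subgraph_adj_sym subgraph_adj_irrefl.

End SubgraphGraph.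

Definition contains_subgraph (U H : sgraph) : Prop :=
  exists S : subgraph U, isomorphic (sgraph_of_subgraph S) H.

Definition connected_set (G : sgraph) (A : {set G}) : Prop :=
  A != set0 /\
  {in A &, forall x y, connect [rel u v | [&& u \in A, v \in A & adj u v]] x y}.

(* [B x] is the branch set of [x]. *)
Definition minor_model (H G : sgraph) (B : H -> {set G}) : Prop :=
  [/\ forall x, connected_set (B x),
      forall x y, x != y -> [disjoint B x & B y]
    & forall x y, adj x y -> exists u v, [/\ u \in B x, v \in B y & adj u v]].

Definition is_minor (H G : sgraph) : Prop :=
  exists B : H -> {set G}, minor_model B.

Section Complete.
Variable m : nat.

Definition complete_adj : rel 'I_m := [rel x y | x != y].

Lemma complete_adj_sym : symmetric complete_adj.
Proof. by move=> x y; rewrite /complete_adj /= eq_sym. Qed.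

Lemma complete_adj_irrefl : irreflexive complete_adj.
Proof. by move=> x; rewrite /complete_adj /= eqxx. Qed.

Definition complete_graph : sgraph :=
  SGraph complete_adj_sym complete_adj_irrefl.

End Complete.

Record path_decomposition (G : sgraph) (s : seq {set G}) : Prop := {
  pd_vertex : forall x : G, exists2 B, B \in s & x \in B;
  pd_edge : forall x y : G, adj x y -> exists B, [/\ B \in s, x \in B & y \in B];
  pd_interval : forall (i j k : nat) (x : G), i <= j <= k -> k < size s ->
    x \in nth set0 s i -> x \in nth set0 s k -> x \in nth set0 s j }.

(* Because of the truncated predecessor, the graph with no vertices gets
   pathwidth 0 instead of -1. *)
Definition pd_width (G : sgraph) (s : seq {set G}) : nat :=
  (\max_(B <- s) #|B|).-1.

Section Pathwidth.
Variable G : sgraph.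

Definition has_pd_width (w : nat) : Prop :=
  exists2 s : seq {set G}, path_decomposition s & pd_width s = w.

Lemma has_pd_width_ex : exists w, `[< has_pd_width w >].
Proof.
exists (pd_width [:: [set: G]]); apply/asboolP; exists [:: [set: G]] => //.
split=> [x|x y _|i j [|k] x] //.
- by exists setT; rewrite ?inE.
- by exists setT; rewrite !inE.
- by rewrite leqn0 andbC => /andP[/eqP->]; rewrite in_setT.
Qed.

Definition pathwidth : nat := ex_minn has_pd_width_ex.

Lemma pathwidth_leP (t : nat) :
  pathwidth <= t <->
  exists2 s : seq {set G}, path_decomposition s & pd_width s <= t.
Proof.
rewrite /pathwidth; case: ex_minnP => w /asboolP[s sP <-] wmin.
split=> [le_t|[s' s'P le_t]]; first by exists s.
by apply: leq_trans le_t; apply: wmin; apply/asboolP; exists s'.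
Qed.

End Pathwidth.

Lemma contains_subgraphP (U H : sgraph) :
  contains_subgraph U H <->
  exists2 f : H -> U, injective f & forall x y, adj x y -> adj (f x) (f y).
Proof.
split=> [[S [f [g fK gK] fM]]|[f f_inj f_adj]].
  exists (fun x => val (g x)) => [x y /val_inj /(can_inj gK) //|x y].
  by rewrite -{1}[x]gK -{1}[y]gK fM => /(@sub_adj_adj U S).
pose F : rel U := fun u v => [exists x, exists y, [&& f x == u, f y == v & adj x y]].
have Fsym1 u v : F u v -> F v u.
  move=> /existsP[x /existsP[y /and3P[xu yv xy]]].
  by apply/existsP; exists y; apply/existsP; exists x; rewrite xu yv adj_sym.
have Fsym : symmetric F by move=> u v; apply/idP/idP; apply: Fsym1.
have Fmem u v : F u v -> (u \in f @: setT) && (v \in f @: setT).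
  move=> /existsP[x /existsP[y /and3P[/eqP<- /eqP<- _]]].
  by rewrite !imset_f.
have Fadj : subrel F (@adj U).
  by move=> u v /existsP[x /existsP[y /and3P[/eqP<- /eqP<- /f_adj]]].
exists (Subgraph Fsym Fmem Fadj).
have fT x : f x \in f @: setT by rewrite imset_f.
pose h x : {u : U | u \in f @: setT} := Sub (f x) (fT x).
have h_inj : injective h by move=> x y /(congr1 val) /f_inj.
have [g hK gK] : bijective h.
  apply: inj_card_bij => //.
  by rewrite card_sig (eq_card (B := f @: setT)) // card_imset // cardsT.
exists g; first by exists h.
move=> u v; rewrite -{2}[u]gK -{2}[v]gK /= /subgraph_adj /=.
apply/idP/existsP=> [xy|[x /existsP[y /and3P[/eqP/f_inj<- /eqP/f_inj<- //]]]].
by exists (g u); apply/existsP; exists (g v); rewrite !eqxx.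
Qed.

(* Main.v *)
(** Join a clique [ds] of [t - 2] vertices completely to a strip of triangles in
    which every new triangle is glued onto one of the two newest edges, as
    dictated by a bit string. Inside the common neighbourhood [N] of the image
    of [ds] the host graph has no [K_4] minor, so each edge across the embedded
    strip separates, within [N], the earlier part of the strip from the later
    part. Hence the image of [ds] and of the first and last strip vertices
    determines the code: reading two codes from the first vertex, the next
    vertices must coincide, and differing bits would let one strip bypass an
    edge of the other. This gives [2 ^ (n - t - 3)] codes mapped injectively
    into [t]-tuples of vertices. *)
Require Import Defs.
From HB Require Import structures.
From mathcomp Require Import all_boot all_order all_algebra.
From mathcomp Require Import boolp reals exp.
From mathcomp Require Import zify.

Set Implicit Arguments.
Unset Strict Implicit.
Unset Printing Implicit Defensive.

Import Order.TTheory GRing.Theory Num.Theory.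

(** * Connected vertex sets, and clique minors from lists of branch sets *)

Section Connectivity.
Variable G : sgraph.
Implicit Types (A B C L R X : {set G}) (u v x : G).

Definition touches A B := [exists u in A, exists v in B, adj u v].

Lemma touchesP A B :
  reflect (exists u v, [/\ u \in A, v \in B & adj u v]) (touches A B).
Proof.
apply: (iffP exists_inP) => [[u uA /exists_inP[v vB uv]]|[u [v [uA vB uv]]]].
  by exists u, v.
by exists u => //; apply/exists_inP; exists v.
Qed.

Lemma touches_sym A B : touches A B = touches B A.
Proof.
by apply/touchesP/touchesP => -[u [v [? ? ?]]]; exists v, u; rewrite adj_sym.
Qed.

Lemma touchesS A A' B B' :
  A \subset A' -> B \subset B' -> touches A B -> touches A' B'.
Proof.
move=> /subsetP sA /subsetP sB /touchesP[u [v [uA vB uv]]].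
by apply/touchesP; exists u, v; rewrite sA ?sB.
Qed.

(** Induction principle for connected sets; with its converse [connected_of_closed] it spares later
    arguments explicit paths. *)
Lemma connected_sub_closed A X u : connected_set A -> u \in A -> u \in X ->
  (forall v w, v \in A -> w \in A -> v \in X -> adj v w -> w \in X) ->
  A \subset X.
Proof.
move=> [_ cA] uA uX clX; apply/subsetP => v vA.
have /connectP[p pP ->] := cA _ _ uA vA.
elim: p u uA uX pP => [|w p IHp] u uA uX //= /andP[/and3P[_ wA uw]] pP.
by apply: (IHp w) => //; apply: clX uw.
Qed.

Lemma connected_of_closed A u : u \in A ->
  (forall X, u \in X ->
    (forall v w, v \in A -> w \in A -> v \in X -> adj v w -> w \in X) ->
    A \subset X) ->
  connected_set A.
Proof.
move=> uA clA; split; first by apply/set0Pn; exists u.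
set e := [rel _ _ | _].
have e_sym : connect_sym e.
  by apply: sym_connect_sym => x y /=; rewrite adj_sym andbCA.
have uc v : v \in A -> connect e u v.
  suff /subsetP/(_ v) sub : A \subset [set v | connect e u v].
    by move=> /sub; rewrite inE.
  apply: clA => [|v' w v'A wA]; rewrite !inE ?connect0 // => uv vw.
  by apply: connect_trans uv (connect1 _); rewrite /= v'A wA.
by move=> x y xA yA; apply: connect_trans (uc _ yA); rewrite e_sym uc.
Qed.

Lemma connected_set1 x : connected_set [set x].
Proof.
apply: (connected_of_closed (set11 x)) => X xX _.
by rewrite sub1set.
Qed.

Lemma connected_setU A B u v : connected_set A -> connected_set B ->
  u \in A -> v \in B -> (u == v) || adj u v -> connected_set (A :|: B).
Proof.
move=> cA cB uA vB uv; have uAB : u \in A :|: B by rewrite inE uA.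
apply: (connected_of_closed uAB) => X uX clX; rewrite subUset.
have vX : v \in X.
  case/orP: uv => [/eqP<- //|]; apply: clX => //.
  by rewrite inE vB orbT.
apply/andP; split.
  apply: (connected_sub_closed cA uA uX) => x y xA yA.
  by apply: clX; rewrite inE ?xA ?yA.
apply: (connected_sub_closed cB vB vX) => x y xB yB.
by apply: clX; rewrite inE ?xB ?yB orbT.
Qed.

Lemma connected_setU1 A u v :
  connected_set A -> u \in A -> adj v u -> connected_set (v |: A).
Proof.
move=> cA uA vu; apply: (connected_setU (connected_set1 v) cA (set11 v) uA).
by rewrite vu orbT.
Qed.

(** Grow [L] inside [C] one vertex at a time until it touches [R]; before that, no added vertex can
    lie in [R]. Growth cannot stall, since [C] is connected and contains points of [R], all outside
    [L]. *)
Lemma connected_extend C L R :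
  connected_set C -> connected_set L -> R != set0 ->
  L \subset C -> R \subset C -> [disjoint L & R] ->
  exists L', [/\ connected_set L', L \subset L', L' \subset C,
                 [disjoint L' & R] & touches L' R].
Proof.
move=> cC + /set0Pn[r rR] + sRC.
have [m] := ubnP #|C :\: L|; elim: m L => // m IHm L leLm cL sLC dLR.
have [LR|nLR] := boolP (touches L R); first by exists L.
have [u [v [uL vC vL uv]]] :
    exists u v, [/\ u \in L, v \in C, v \notin L & adj u v].
  apply: contrapT => no.
  have [/set0Pn[u uL] _] := cL.
  have /subsetP sCL : C \subset L.
    apply: (connected_sub_closed cC (subsetP sLC _ uL) uL) => x y xC yC xL xy.
    by apply: contrapT => /negP yL; apply: no; exists x, y.
  have rL := sCL _ (subsetP sRC _ rR).
  by rewrite (disjointFl dLR rR) in rL.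
have vR : v \notin R.
  by apply: contra nLR => vR; apply/touchesP; exists u, v.
have [| | | |L' [cL' sL' sC' dL' tL']] := IHm (v |: L).
- rewrite -ltnS; apply: leq_trans leLm; rewrite ltnS.
  apply: proper_card; rewrite properE setDS ?subsetUr //=.
  apply/subsetPn; exists v; rewrite !inE ?vC ?vL //.
  by rewrite eqxx.
- by apply: (connected_setU1 cL uL); rewrite adj_sym.
- by rewrite subUset sub1set vC.
- by rewrite disjoint_sym disjoints_subset setCU subsetI -!disjoints_subset
    disjoint_sym disjoints1 vR disjoint_sym.
exists L'; split=> //.
by apply: subset_trans sL'; apply: subsetUr.
Qed.

Lemma clique_minor_of_seq (Bs : seq {set G}) :
  (forall B, B \in Bs -> connected_set B) ->
  pairwise [rel A B : {set G} | [disjoint A & B] && touches A B] Bs ->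
  is_minor (complete_graph (size Bs)) G.
Proof.
move=> cBs pBs; exists (fun i : 'I__ => nth set0 Bs i).
have pB (i j : 'I_(size Bs)) : i != j ->
    [disjoint nth set0 Bs i & nth set0 Bs j] &&
    touches (nth set0 Bs i) (nth set0 Bs j).
  have/(pairwiseP set0) P := pBs.
  rewrite -val_eqE neq_ltn => /orP[] ij; first by apply: P; rewrite ?inE.
  by rewrite disjoint_sym touches_sym; apply: P; rewrite ?inE.
split=> [i|i j /pB/andP[]//|i j /pB/andP[_ /touchesP]//].
by apply: cBs; apply: mem_nth.
Qed.

End Connectivity.

(** * Strips of triangles and their codes *)

Section Ladder.
Variables (T : eqType) (e : rel T).
Implicit Types (a b : T) (r : seq T) (s : seq bool).

(* [r] lists the vertices of a strip of triangles glued onto the edge [a b];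
   the code [s] tells for each new vertex which end of the current edge
   survives. *)
Fixpoint ladder a b s r : bool :=
  if r is w :: r' then
    [&& e a b, e a w, e b w &
      match s with
      | [::] => nilp r'
      | c :: s' => if c then ladder a w s' r' else ladder w b s' r'
      end]
  else false.

(** Bits refer to the ends of the current edge by position, so exchanging the ends flips every
    bit. *)
Lemma ladder_swap : symmetric e ->
  forall s a b r, ladder a b s r = ladder b a (map negb s) r.
Proof.
move=> e_sym s; elim: s => [|c s IHs] a b [|w r] //=.
  by rewrite e_sym [e a w && _]andbCA.
rewrite e_sym [e a w && _]andbCA; congr [&& _, _, _ & _].
by case: c => /=.
Qed.

End Ladder.

Lemma ladder_map (T T' : eqType) (e : rel T) (e' : rel T') (f : T -> T') :
  (forall x y, e x y -> e' (f x) (f y)) ->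
  forall s a b r, ladder e a b s r -> ladder e' (f a) (f b) s (map f r).
Proof.
move=> fP s; elim: s => [|c s IHs] a b [|w r] //= /and4P[/fP-> /fP-> /fP->] /=.
  by case: r.
by case: c => /IHs.
Qed.

(** * Separation by strip edges in a set without [K_4] model *)

Section Separation.
Variables (G : sgraph) (N : {set G}).
Implicit Types (L R P : {set G}) (a b p q w x y : G) (s : seq bool).

(** Phrased with lists of branch sets inside [N], so that singletons of the clique [ds] can simply
    be prepended. *)
Definition no_K4_model := forall Bs : seq {set G}, size Bs = 4 ->
  (forall B, B \in Bs -> connected_set B /\ B \subset N) ->
  ~~ pairwise [rel A B : {set G} | [disjoint A & B] && touches A B] Bs.

Hypothesis noK4 : no_K4_model.

(** The configuration that forces separation. In use, [L] holds what the strip has left behind and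
    [R] what is still to come. *)
Record bridge p q L R : Prop := Bridge {
  bridge_adj : adj p q;
  bridge_mem : (p \in N) && (q \in N);
  bridge_connL : connected_set L;
  bridge_connR : connected_set R;
  bridge_subL : L \subset N;
  bridge_subR : R \subset N;
  bridge_disj : [disjoint L & R];
  bridge_notinL : (p \notin L) && (q \notin L);
  bridge_notinR : (p \notin R) && (q \notin R);
  bridge_touchL : touches [set p] L && touches [set q] L;
  bridge_touchR : touches [set p] R && touches [set q] R }.

Lemma bridge_sym p q L R : bridge p q L R -> bridge q p L R.
Proof.
case=> *; split; rewrite // 1?adj_sym // andbC //.
Qed.

Lemma adj_neq p q : @adj G p q -> p != q.
Proof. by apply: contraTneq => ->; rewrite adj_irrefl. Qed.

(* A connected set [P] bypassing the edge [p q] would merge [L] and [R] into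
   one connected set, which splits into two adjacent sets: with [p] and [q]
   these form a [K_4]. *)
Lemma bridge_separates p q L R P u v : bridge p q L R ->
  connected_set P -> P \subset N -> p \notin P -> q \notin P ->
  u \in L -> u \in P -> v \in R -> v \in P -> False.
Proof.
case=> pq /andP[pN qN] cL cR sL sR dLR /andP[pL qL] /andP[pR qR].
move=> /andP[tpL tqL] /andP[tpR tqR] cP sP pP qP uL uP vR vP.
have cLP : connected_set (L :|: P).
  by apply: (connected_setU cL cP uL uP); rewrite eqxx.
pose C := L :|: P :|: R.
have cC : connected_set C.
  apply: (connected_setU cLP cR (u := v) _ vR); last by rewrite eqxx.
  by rewrite inE vP orbT.
have sLC : L \subset C by rewrite /C -setUA subsetUl.
have sRC : R \subset C by rewrite /C subsetUr.
have R0 : R != set0 by apply/set0Pn; exists v.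
have [L' [cL' sLL' sL'C dL'R tL'R]] := connected_extend cC cL R0 sLC sRC dLR.
have sCN : C \subset N by rewrite !subUset sL sP.
have pC : p \notin C by rewrite !inE !negb_or pL pP.
have qC : q \notin C by rewrite !inE !negb_or qL qP.
have pL' : p \notin L' by apply: contra pC; apply: (subsetP sL'C).
have qL' : q \notin L' by apply: contra qC; apply: (subsetP sL'C).
apply: (negP (noK4 (Bs := [:: [set p]; [set q]; L'; R]) (erefl _) _)).
  move=> B; rewrite !inE => /or4P[] /eqP->; split; rewrite ?sub1set //.
  - exact: connected_set1.
  - exact: connected_set1.
  - exact: subset_trans sL'C sCN.
rewrite /= !disjoints1 inE (adj_neq pq) pL' pR qL' qR dL'R tL'R tpR tqR.
rewrite (touchesS _ sLL' tpL) // (touchesS _ sLL' tqL) // !andbT /=.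
by apply/touchesP; exists p, q; rewrite !inE !eqxx.
Qed.

(** The set formed by [a], [w'] and [R'] leads from [a] to [y], so it cannot avoid the edge [w b]
    and must contain [w]. If [w] lay in [R'], then [a] and [R'], joined through [a w], would bypass
    [w' b]. *)
Lemma bridge_same a b w w' L R R' y :
  bridge w b (a |: L) R -> bridge w' b (a |: L) R' ->
  adj a w -> adj a w' -> a \in N -> y \in R -> y \in R' -> w = w'.
Proof.
move=> br br' aw aw' aN yR yR'.
have aL : a \in a |: L by rewrite setU11.
have [_ /andP[_ bN] _ _ _ _ _ /andP[wL bL] _ _ _] := br.
have [_ /andP[w'N _] _ cR' _ sR' _ /andP[w'L _] /andP[w'R' bR'] _] := br'.
move=> /andP[/touchesP[w1 [v [/set1P-> vR' w'v]]] _].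
have [wa ba w'a] : [/\ w != a, b != a & w' != a].
  by move: wL bL w'L; rewrite !inE !negb_or => /andP[? _] /andP[? _] /andP[].
have wP : w \in a |: (w' |: R').
  apply: contrapT => /negP wP; apply: (bridge_separates br (P := a |: (w' |: R'))
    (u := a) (v := y)) => //; rewrite ?inE ?eqxx ?yR' ?orbT //.
  - apply: (connected_setU1 (u := w')) => //; first exact: (connected_setU1 _ vR').
    by rewrite setU11.
  - by rewrite !subUset !sub1set aN w'N.
  - rewrite !negb_or ba bR' andbT eq_sym /=.
    by have [] := br' => /adj_neq.
move: wP; rewrite !inE (negPf wa) /= => /orP[/eqP//|wR'].
exfalso; apply: (bridge_separates br' (P := a |: R') (u := a) (v := y)) => //;
  rewrite ?inE ?eqxx ?yR' ?orbT // ?negb_or ?w'a ?ba //.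
- by apply: connected_setU1 wR' aw.
- by rewrite subUset sub1set aN.
Qed.

(* When the strips drop different ends of [a b], the second one must reach its
   far part from [a] through [w]; then it also does so from [b] through [w]. *)
Lemma bridge_mixed a b w w' L R R' y :
  bridge w b (a |: L) R -> bridge a w' (b |: L) R' -> b \notin R' ->
  y \in R -> y \in R' -> False.
Proof.
move=> br br' bR' yR yR'.
have [wb /andP[wN bN] _ _ _ _ _ /andP[wL bL] _ _ _] := br.
have [aw' /andP[aN w'N] _ cR' _ sR' _ /andP[aL w'L] /andP[aR' w'R'] _] := br'.
move=> /andP[/touchesP[a1 [v [/set1P-> vR' av]]] _].
have [wa ba] : w != a /\ b != a.
  by move: wL bL; rewrite !inE !negb_or => /andP[? _] /andP[].
have w'b : w' != b by move: w'L; rewrite !inE !negb_or => /andP[].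
have wP : w \in a |: R'.
  apply: contrapT => /negP wP; apply: (bridge_separates br (P := a |: R')
    (u := a) (v := y)) => //; rewrite ?inE ?eqxx ?yR' ?orbT //.
  - by apply: connected_setU1 vR' av.
  - by rewrite subUset sub1set aN.
  - by rewrite negb_or ba.
have wR' : w \in R' by move: wP; rewrite !inE (negPf wa).
apply: (bridge_separates br' (P := b |: R') (u := b) (v := y)) => //;
  rewrite ?inE ?eqxx ?yR' ?orbT // ?negb_or ?w'b ?w'R' ?aR' ?andbT //.
- by apply: (connected_setU1 cR' wR'); rewrite adj_sym.
- by rewrite subUset sub1set bN.
- by rewrite eq_sym.
Qed.

(** Neither [a] nor [b] lies in [R'], since [x] could then enter [R'] there and bypass [a' b']. So
    if [a'] or [b'] were not an end of [a b], passing from [x] through it into [R'] would bypass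
    [a b]. *)
Lemma bridge_start a b a' b' x R R' y :
  bridge a b [set x] R -> bridge a' b' [set x] R' -> y \in R -> y \in R' ->
  (a = a' /\ b = b') \/ (a = b' /\ b = a').
Proof.
have avoid p q p' q' S S' : bridge p q [set x] S -> bridge p' q' [set x] S' ->
    y \in S -> y \in S' -> p \notin S'.
  move=> br br' yS yS'; apply/negP => pS'.
  have [_ _ _ _ sx _ _ _ _ /andP[/touchesP[p1 [x1 []]] ]] := br.
  move=> /set1P-> /set1P-> px _ _.
  have [_ _ _ cS' _ sS' _ /andP[p'x q'x] /andP[p'S' q'S'] _ _] := br'.
  apply: (bridge_separates br' (P := x |: S') (u := x) (v := y)) => //;
    rewrite ?inE ?eqxx ?yS' ?orbT // ?negb_or -?in_set1 ?p'x ?q'x //.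
  - by apply: (connected_setU1 cS' pS'); rewrite adj_sym.
  - by rewrite subUset sx.
move=> br br' yR yR'.
have aR' := avoid _ _ _ _ _ _ br br' yR yR'.
have bR' := avoid _ _ _ _ _ _ (bridge_sym br) br' yR yR'.
have meet p q : bridge p q [set x] R' -> (p == a) || (p == b).
  move=> brp; apply: contrapT => /negP; rewrite negb_or => /andP[pa pb].
  have [_ _ _ _ sx _ _ /andP[ax bx] _ _ _] := br.
  have [pq /andP[pN _] _ cR' _ sR' _ _ _ /andP[tpx _] /andP[tpR' _]] := brp.
  move/touchesP: tpx => [p1 [x1 [/set1P-> /set1P-> px]]].
  move/touchesP: tpR' => [p1' [v [/set1P-> vR' pv]]].
  apply: (bridge_separates br (P := x |: (p |: R')) (u := x) (v := y)) => //;
    rewrite ?inE ?eqxx ?yR' ?orbT // ?negb_or -?in_set1 ?ax ?bx ?aR' ?bR' //=.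
  - apply: (connected_setU1 (u := p)); rewrite ?setU11 1?adj_sym //.
    by apply: connected_setU1 vR' pv.
  - by rewrite !subUset sx sub1set pN.
  - by rewrite in_set1 eq_sym pa.
  - by rewrite in_set1 eq_sym pb.
have nab' : a' != b' by apply: adj_neq; case: br'.
case/orP: (meet _ _ br') => /eqP a'E; case/orP: (meet _ _ (bridge_sym br')) => /eqP b'E.
- by rewrite a'E b'E eqxx in nab'.
- by left.
- by right.
- by rewrite a'E b'E eqxx in nab'.
Qed.

(** The two contacts strengthen the induction: the newest vertex is an end of the next edge, hence
    sees the rest of the strip. *)
Lemma ladder_connected s a b r : ladder (@adj G) a b s r ->
  [/\ adj a b, connected_set [set x in r], touches [set a] [set x in r] &
      touches [set b] [set x in r]].
Proof.
have touch w (q : seq G) p : adj p w -> touches [set p] [set x in w :: q].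
  by move=> pw; apply/touchesP; exists p, w; rewrite !inE !eqxx.
elim: s a b r => [|c s IHs] a b [|w r] //= /and4P[ab aw bw lr].
  split; [by [] | | exact: touch | exact: touch].
  move: lr => /nilP->; suff -> : [set x in [:: w]] = [set w].
    exact: connected_set1.
  by apply/setP => x; rewrite !inE.
split; [by [] | | exact: touch | exact: touch]; rewrite set_cons.
have step : connected_set [set x in r] -> touches [set w] [set x in r] ->
    connected_set (w |: [set x in r]).
  by move=> cr /touchesP[? [v [/set1P-> vr wv]]]; apply: connected_setU1 vr wv.
by case: c lr => /IHs[_ cr ta tb]; apply: step.
Qed.

(** [fresh] constrains the vertices to come, [dock] those already passed. Together with a ladder
    they yield a [bridge], and both survive advancing the edge. *)
Definition fresh L a b (r : seq G) :=
  [&& uniq [:: a, b & r], all (mem N) r & all (fun x => x \notin L) r].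

Definition dock L a b := [/\ connected_set L, L \subset N,
  (a \in N) && (b \in N), (a \notin L) && (b \notin L) &
  touches [set a] L && touches [set b] L].

Lemma ladder_bridge L a b s r : dock L a b -> fresh L a b r ->
  ladder (@adj G) a b s r -> bridge a b L [set x in r].
Proof.
move=> [cL sL abN abL tL] /and3P[/= /and3P[ar br ur] /allP rN /allP rL].
move=> /ladder_connected[ab cr ta tb]; split=> //; rewrite ?ta //.
- by apply/subsetP => x; rewrite inE => /rN.
- by rewrite disjoint_sym disjoint_subset; apply/subsetP => x; rewrite inE => /rL.
- by move: ar; rewrite !inE negb_or => /andP[_ ->].
Qed.

Lemma dockS L a b w : dock L a b -> adj a b -> adj a w -> w \in N ->
  w \notin L -> b != w -> dock (a |: L) w b.
Proof.
move=> [cL sL /andP[aN bN] /andP[aL bL] /andP[ta tb]] ab aw wN wL bw.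
have [a1 [l [/set1P-> lL al]]] := touchesP _ _ ta.
have touch p : adj a p -> touches [set p] (a |: L).
  by move=> ap; apply/touchesP; exists p, a; rewrite !inE !eqxx adj_sym.
split; rewrite ?inE ?negb_or ?wN ?bN ?wL ?bL ?touch ?andbT //.
- by apply: connected_setU1 lL al.
- by rewrite subUset sub1set aN.
- by rewrite ![_ == a]eq_sym !adj_neq.
Qed.

Lemma freshS L a b w r : fresh L a b (w :: r) -> fresh (a |: L) w b r.
Proof.
move=> /and3P[/= /and4P[+ + wr ur] /andP[_ rN] /andP[_ /allP rL]].
rewrite !inE !negb_or => /and3P[_ _ ar] /andP[bw br].
apply/and3P; split=> //=; first by rewrite !inE negb_or eq_sym bw wr br.
apply/allP => x xr; rewrite !inE negb_or rL // andbT.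
by apply: contraNneq ar => <-.
Qed.

Lemma dock_sym L a b : dock L a b -> dock L b a.
Proof. by case=> *; split=> //; rewrite andbC. Qed.

Lemma fresh_sym L a b r : fresh L a b r -> fresh L b a r.
Proof.
rewrite /fresh /= => /and3P[/and3P[+ br ->] -> ->]; rewrite !inE !negb_or.
by move=> /andP[ab ->]; rewrite eq_sym ab br.
Qed.

(** Induction along both strips at once. Their common last vertex is the [y] of the bridge lemmas:
    equal bits force equal new vertices by [bridge_same], different bits are refuted by
    [bridge_mixed]. *)
Lemma ladder_code_inj s s' a b L r r' :
  dock L a b -> fresh L a b r -> fresh L a b r' ->
  ladder (@adj G) a b s r -> ladder (@adj G) a b s' r' ->
  size s = size s' -> last a r = last a r' -> s = s'.
Proof.
elim: s s' a b L r r' => [|c s IHs] [|c' s'] a b L [|w r] [|w' r'] // dL fr fr'.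
have step p q L1 w1 r1 : dock L1 p q -> adj p q -> adj p w1 ->
    fresh L1 p q (w1 :: r1) -> dock (p |: L1) w1 q /\ fresh (p |: L1) w1 q r1.
  move=> d pq pw f; split; last exact: freshS f.
  move: f => /and3P[/= /and3P[_ + _] /andP[w1N _] /andP[w1L _]].
  by rewrite inE negb_or => /andP[qw1 _]; apply: dockS.
(* A ladder has at least one vertex, so the last one lies strictly beyond [w1]. *)
have lastE p q s1 w1 r1 : ladder (@adj G) p q s1 r1 ->
    last p (w1 :: r1) \in [set x in r1].
  by case: s1 r1 => [|? ?] [|v r1] //= _; rewrite inE mem_last.
have lastX p q s1 r1 z z' : ladder (@adj G) p q s1 r1 -> last z r1 = last z' r1.
  by case: s1 r1 => [|? ?] [].
move=> /= /and4P[ab aw bw lr] /and4P[_ aw' bw' lr'] [ss'] lastE'.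
have ba : adj b a by rewrite adj_sym.
have [_ _ /andP[aN bN] _ _] := dL.
have [da fa] := step _ _ _ _ _ dL ab aw fr.
have [da' fa'] := step _ _ _ _ _ dL ab aw' fr'.
(* The mirrored data, with [a] and [b] exchanged, serve the bit [true], which drops [b]. *)
have [db fb] := step _ _ _ _ _ (dock_sym dL) ba bw (fresh_sym fr).
have [db' fb'] := step _ _ _ _ _ (dock_sym dL) ba bw' (fresh_sym fr').
have brr : b \notin [set x in r].
  by have /and3P[/= /and3P[_ + _] _ _] := fr; rewrite !inE negb_or => /andP[].
have br' : b \notin [set x in r'].
  by have /and3P[/= /and3P[_ + _] _ _] := fr'; rewrite !inE negb_or => /andP[].
have yr : last w r \in [set x in r].
  by case: c lr => /(lastE _ _ _ w).
have yr' : last w r \in [set x in r'].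
  by rewrite lastE'; case: c' lr' => /(lastE _ _ _ w').
case: c c' lr lr' => [] [] lr lr'.
- have wE : w = w'.
    apply: (bridge_same _ _ bw bw' bN yr yr'); apply: bridge_sym.
      exact: ladder_bridge (dock_sym db) (fresh_sym fb) lr.
    exact: ladder_bridge (dock_sym db') (fresh_sym fb') lr'.
  rewrite -wE in lr' db' fb'.
  congr (_ :: _); apply: (IHs s' a w (b |: L) r r' _ _ _ lr lr' ss').
  + exact: dock_sym.
  + exact: fresh_sym.
  + exact: fresh_sym.
  + by rewrite (lastX _ _ _ _ a w lr) (lastX _ _ _ _ a w lr') lastE' wE.
- exfalso; apply: (bridge_mixed _ _ brr yr' yr).
    exact: ladder_bridge da' fa' lr'.
  exact: ladder_bridge (dock_sym db) (fresh_sym fb) lr.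
- exfalso; apply: (bridge_mixed _ _ br' yr yr').
    exact: ladder_bridge da fa lr.
  exact: ladder_bridge (dock_sym db') (fresh_sym fb') lr'.
- have wE : w = w'.
    apply: (bridge_same _ _ aw aw' aN yr yr').
      exact: ladder_bridge da fa lr.
    exact: ladder_bridge da' fa' lr'.
  rewrite -wE in lr' da' fa' lastE'.
  congr (_ :: _); exact: (IHs s' w b (a |: L) r r').
Qed.

End Separation.

(** * Recovering the code from the clique image and the strip ends *)

Section CodeUniqueness.
Variable G : sgraph.

(** Each vertex of [ds] sees every nonempty set inside the common neighbourhood and, by
    irreflexivity, lies in none of them. Its singleton can therefore join any [K_4] model found
    there. *)
Lemma apex_no_K4_model (ds : seq G) : pairwise (@adj G) ds ->
  ~ is_minor (complete_graph (size ds + 4)) G ->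
  no_K4_model [set v | all (adj v) ds].
Proof.
move=> cl no Bs szBs BsP; apply/negP => pBs; apply: no.
have -> : size ds + 4 = size ([seq [set d] | d <- ds] ++ Bs).
  by rewrite size_cat size_map szBs.
apply: clique_minor_of_seq => [B|].
  rewrite mem_cat => /orP[/mapP[d _ ->]|/BsP[]//]; exact: connected_set1.
rewrite pairwise_cat pBs andbT pairwise_map; apply/andP; split.
  apply/allrelP => _ B /mapP[d dds ->] BB /=.
  have [[/set0Pn[v vB] _] /subsetP sB] := BsP B BB.
  have adjd u : u \in B -> adj d u.
    by move=> /sB; rewrite inE => /allP/(_ d dds); rewrite adj_sym.
  rewrite disjoints1; apply/andP; split.
    by apply/negP => /adjd; rewrite adj_irrefl.
  by apply/touchesP; exists d, v; rewrite set11 adjd.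
apply: sub_pairwise cl => d d' dd' /=; rewrite disjoints1 inE (adj_neq dd') /=.
by apply/touchesP; exists d, d'; rewrite !set11.
Qed.

(* Both leading bits are fixed: the first one leaves [x] behind the current
   edge, the second one fixes the order of the ends of that edge. *)
Lemma ladder_code_unique (N : {set G}) (x b b' : G) (r r' : seq G)
    (c c' : seq bool) :
  no_K4_model N -> uniq [:: x, b & r] -> uniq [:: x, b' & r'] ->
  all (mem N) [:: x, b & r] -> all (mem N) [:: x, b' & r'] ->
  ladder (@adj G) x b [:: false, false & c] r ->
  ladder (@adj G) x b' [:: false, false & c'] r' ->
  size c = size c' -> last x r = last x r' -> c = c'.
Proof.
case: r r' => [|w r] [|w' r'] // noK4.
have start b0 w0 r0 c0 : uniq [:: x, b0, w0 & r0] ->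
    all (mem N) [:: x, b0, w0 & r0] ->
    ladder (@adj G) x b0 [:: false, false & c0] (w0 :: r0) ->
    [/\ dock N [set x] w0 b0, fresh N [set x] w0 b0 r0,
        ladder (@adj G) w0 b0 (false :: c0) r0 & last w0 r0 \in [set v in r0]].
  move=> /= /and4P[]; rewrite !inE !negb_or => /and3P[xb xw xr] /andP[bw br] wr ur.
  move=> /and4P[xN bN wN rN] /and4P[exb exw ebw lr].
  have touch u : adj x u -> touches [set u] [set x].
    by move=> xu; apply/touchesP; exists u, x; rewrite !set11 adj_sym.
  split=> //.
  - split; rewrite ?sub1set ?touch //; first exact: connected_set1.
      by apply/andP.
    by rewrite !inE ![_ == x]eq_sym xw.
  - rewrite /fresh /= inE negb_or eq_sym bw wr br ur rN /=.
    by apply/allP => u ur0; rewrite inE; apply: contraNneq xr => <-.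
  - by case: (r0) lr => [//|? ?] _; rewrite /= mem_last.
move=> u u' aN aN' l l' szc lastE.
have [d f lr yr] := start _ _ _ _ u aN l.
have [d' f' lr' yr'] := start _ _ _ _ u' aN' l'.
have /= E : last w r = last w' r' := lastE.
rewrite -E in yr'.
have [[wE bE]|[wE bE]] := bridge_start noK4 (ladder_bridge d f lr)
  (ladder_bridge d' f' lr') yr yr'.
  subst w' b'; suff [//] : false :: c = false :: c'.
  by apply: (ladder_code_inj noK4 d f f' lr lr') => //=; rewrite szc.
(* With crossed ends, the second code read in the order of the first begins with [true], not
   [false]. *)
subst w b; have: false :: c = map negb (false :: c'); last by [].

rewrite ladder_swap in lr'; last exact: adj_sym.
apply: (ladder_code_inj noK4 d f (fresh_sym f') lr lr') => /=.
  by rewrite size_map szc.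
by case: (r) (r') lr lr' E => [|? ?] [|? ?].
Qed.

End CodeUniqueness.

(** * Graphs whose bags are cliques *)

Section BagGraph.
Variables (T : finType) (Bs : seq {set T}).

Definition bag_adj : rel T :=
  [rel u v | (u != v) && has (fun B : {set T} => (u \in B) && (v \in B)) Bs].

Lemma bag_adj_sym : symmetric bag_adj.
Proof.
move=> u v; rewrite /bag_adj /= eq_sym; congr (_ && _).
by apply: eq_has => B; rewrite andbC.
Qed.

Lemma bag_adj_irrefl : irreflexive bag_adj.
Proof. by move=> u; rewrite /bag_adj /= eqxx. Qed.

Definition bag_graph := SGraph bag_adj_sym bag_adj_irrefl.

Lemma bag_adj_mem B u v : B \in Bs -> u \in B -> v \in B -> u != v -> bag_adj u v.
Proof.
by move=> BB uB vB uv; apply/andP; split=> //; apply/hasP; exists B; rewrite ?uB.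
Qed.

End BagGraph.

(** * Path decompositions and embeddings of a clique joined to a strip *)

Section LadderBags.
Variable T : finType.
Implicit Types (a b x : T) (r ds : seq T) (s : seq bool) (B : {set T}).

(** The triangles in gluing order; adding [ds] to each gives the bags of the path decomposition. *)
Fixpoint ladder_bags a b s r : seq {set T} :=
  if r is w :: r' then
    [set a; b; w] ::
      match s with
      | [::] => [::]
      | c :: s' => if c then ladder_bags a w s' r' else ladder_bags w b s' r'
      end
  else [::].

Lemma ladder_bags_sub s a b r B x :
  B \in ladder_bags a b s r -> x \in B -> x \in [:: a, b & r].
Proof.
elim: s a b r => [|c s IHs] a b [|w r] //=; rewrite inE.
  by move=> /eqP->; rewrite !inE -!orbA => /or3P[] ->; rewrite ?orbT.
case/orP => [/eqP->|].
  by rewrite !inE -!orbA => /or3P[] ->; rewrite ?orbT.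
by case: c => /IHs/[apply]; rewrite !inE => /or3P[] ->; rewrite ?orbT.
Qed.

Lemma card_ladder_bags s a b r B : B \in ladder_bags a b s r -> #|B| <= 3.
Proof.
have card3 (u v w : T) : #|[set u; v; w]| <= 3.
  by rewrite -setUA cardsU1 cards2; do 2!case: (_ \notin _) || case: (_ != _).
elim: s a b r => [|c s IHs] a b [|w r] //=; rewrite inE.
  by move=> /eqP->.
by case/orP => [/eqP->//|]; case: c; apply: IHs.
Qed.

Lemma ladder_bags_cover s a b r x : size r = (size s).+1 ->
  x \in [:: a, b & r] -> exists2 B, B \in ladder_bags a b s r & x \in B.
Proof.
elim: s a b r => [|c s IHs] a b [|w r] //= [szr] xr.
  exists [set a; b; w]; rewrite ?inE // -orbA.
  by move: xr; rewrite (size0nil szr) !inE.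
have [xB|xB] := boolP (x \in [set a; b; w]).
  by exists [set a; b; w]; rewrite ?mem_head.
have xr' : x \in r.
  by move: xB xr; rewrite !inE !negb_or => /andP[/andP[/negPf-> /negPf->] /negPf->].
by case: c; [have [|B BB xB'] := IHs a w r szr|have [|B BB xB'] := IHs w b r szr];
  rewrite ?inE ?xr' ?orbT //; exists B; rewrite // inE BB orbT.
Qed.

(** The real case is a vertex of the first triangle that recurs later. It is not the dropped end,
    which no later bag contains, so it lies on the surviving edge, hence in the second bag, and
    induction applies. *)
Lemma ladder_bags_interval s a b r : uniq [:: a, b & r] ->
  forall i j k x, i <= j <= k -> k < size (ladder_bags a b s r) ->
  x \in nth set0 (ladder_bags a b s r) i ->
  x \in nth set0 (ladder_bags a b s r) k ->
  x \in nth set0 (ladder_bags a b s r) j.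
Proof.
elim: s a b r => [|c s IHs] a b [|w r] //= /and4P[].
  move=> _ _ _ _ i j k x ijk; rewrite ltnS leqn0 => /eqP k0.
  by move: ijk; rewrite k0 leqn0 andbC => /andP[/eqP->].
rewrite !inE !negb_or => /and3P[ab aw ar] /andP[bw br] wr ur.
case=> [|i] [|j] [|k] x // ijk ltk; [|by rewrite andbF in ijk|]; last first.
  by case: c ltk => ltk; apply: (IHs _ _ _ _ i j k x ijk ltk) => //=;
    rewrite !inE ?negb_or ?aw ?ar ?wr ?ur ?br ?[w == b]eq_sym ?bw.
have first p q k' : k' < size (ladder_bags p q s r) -> x \in [:: p; q] ->
    x \in nth set0 (ladder_bags p q s r) 0.
  case: s {IHs ltk} r {ar br wr ur} => [|c' s] [|v r] //= _;
  by rewrite !inE => ->.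
move=> /= xabw xk; case: c ltk xk => ltk xk.
  apply: (IHs a w r _ 0 j k x) => //=.
    by rewrite !inE negb_or aw ar wr.
  apply: (first _ _ _ ltk); move: xabw; rewrite !inE -orbA => /or3P[->//|/eqP xb|->].
    have := ladder_bags_sub (mem_nth set0 ltk) xk.
    by rewrite xb !inE eq_sym (negPf ab) (negPf bw) (negPf br).
  by rewrite orbT.
apply: (IHs w b r _ 0 j k x) => //=.
  by rewrite !inE negb_or eq_sym bw wr br.
apply: (first _ _ _ ltk); move: xabw; rewrite !inE -orbA => /or3P[/eqP xa|->|->//].
  have := ladder_bags_sub (mem_nth set0 ltk) xk.
  by rewrite xa !inE (negPf ab) (negPf aw) (negPf ar).
by rewrite orbT.
Qed.

Lemma ladder_of_bags (e : rel T) s a b r :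
  (forall B u v, B \in ladder_bags a b s r -> u \in B -> v \in B -> u != v ->
    e u v) ->
  uniq [:: a, b & r] -> size r = (size s).+1 -> ladder e a b s r.
Proof.
elim: s a b r => [|c s IHs] a b [|w r] //= eP /and4P[].
all: rewrite !inE !negb_or => /and3P[ab aw ar] /andP[bw br] wr ur [szr].
all: have eabw u v := eP [set a; b; w] u v (mem_head _ _).
all: rewrite !eabw ?inE ?eqxx ?orbT //=.
  by rewrite (size0nil szr).
case: c eP => eP; apply: IHs => //=.
- by move=> B u v BB; apply: eP; rewrite inE BB orbT.
- by rewrite !inE negb_or aw ar wr.
- by move=> B u v BB; apply: eP; rewrite inE BB orbT.
- by rewrite !inE negb_or eq_sym bw wr br.
Qed.

Definition apex_ladder ds a b s r : sgraph :=
  bag_graph [seq [set x in ds] :|: B | B <- ladder_bags a b s r].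

(** A triangle together with [ds] has at most [size ds + 3] elements, one more than the width. *)
Lemma pathwidth_apex_ladder ds a b s r : uniq [:: a, b & r] ->
  (forall x, x \in ds ++ [:: a, b & r]) -> size r = (size s).+1 ->
  pathwidth (apex_ladder ds a b s r) <= size ds + 2.
Proof.
move=> ur cov szr; apply/pathwidth_leP.
pose D := [set x in ds]; pose Bs := ladder_bags a b s r.
exists [seq D :|: B | B <- Bs]; last first.
  rewrite /pd_width -subn1 leq_subLR add1n -addnS; apply/bigmax_leqP_seq => A.
  move=> /mapP[B /card_ladder_bags leB ->] _.
  rewrite (leq_trans (leq_card_setU _ _)) // leq_add // cardsE.
  exact: card_size.
split=> [x|x y /andP[_ /hasP[B BB /andP[xB yB]]]|i j k x ijk].
(* Vertices of [ds] lie in every bag, so some bag has to be exhibited. *)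
- have [B0 B0s _] : exists2 B, B \in Bs & a \in B.
    by apply: ladder_bags_cover; rewrite ?inE ?eqxx.
  have := cov x; rewrite mem_cat => /orP[xD|/(ladder_bags_cover szr)[B BB xB]].
    by exists (D :|: B0); rewrite ?inE ?xD //; apply: map_f.
  by exists (D :|: B); rewrite ?inE ?xB ?orbT //; apply: map_f.
- by exists B.
- rewrite size_map => ltk; have /andP[ij jk] := ijk.
  have ltj := leq_ltn_trans jk ltk; have lti := leq_ltn_trans ij ltj.
  rewrite !(nth_map set0) // !inE; case: (x \in ds) => //=.
  exact: ladder_bags_interval ijk ltk.
Qed.

Lemma apex_ladder_embedding (U : sgraph) ds a b s r :
  uniq (ds ++ [:: a, b & r]) -> (forall x, x \in ds ++ [:: a, b & r]) ->
  size r = (size s).+1 -> contains_subgraph U (apex_ladder ds a b s r) ->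
  exists f : T -> U, [/\ injective f, pairwise (@adj U) (map f ds),
    all (mem [set v | all (adj v) (map f ds)]) (map f [:: a, b & r]) &
    ladder (@adj U) (f a) (f b) s (map f r)].
Proof.
rewrite cat_uniq => /and3P[uds /hasPn disj ur] cov szr.
move=> /contains_subgraphP[f f_inj f_adj]; exists f.
pose D := [set x in ds]; pose Bs := ladder_bags a b s r.
have eP B u v : B \in Bs -> u \in D :|: B -> v \in D :|: B -> u != v ->
    adj (f u) (f v).
  by move=> BB uB vB uv; apply: f_adj; apply: bag_adj_mem uB vB uv; apply: map_f.
split=> //.
- have [B BB _] : exists2 B, B \in Bs & a \in B.
    by apply: ladder_bags_cover; rewrite ?inE ?eqxx.
  rewrite pairwise_map; move: uds; rewrite uniq_pairwise.
  apply: (sub_in_pairwise (P := mem ds)); last by apply/allP.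
  by move=> u v uds vds /=; apply: eP BB _ _; rewrite !inE (uds, vds).
- rewrite all_map; apply/allP => x xr; rewrite /= inE all_map.
  apply/allP => d dds /=; have [B BB xB] := ladder_bags_cover szr xr.
  apply: eP BB _ _ _; rewrite ?inE ?xB ?dds ?orbT //.
  by apply: contraNneq (disj x xr) => ->.
- apply: (ladder_map (e := fun u v => adj (f u) (f v))) => //.
  apply: ladder_of_bags => // B u v BB uB vB; apply: eP BB _ _.
    by rewrite inE uB orbT.
  by rewrite inE vB orbT.
Qed.

End LadderBags.

(** * Counting codes in the host graph *)

Lemma universal_graph_card (n t : nat) (U : sgraph) :
  2 <= t -> t < n ->
  ~ is_minor (complete_graph (t + 2)) U ->
  (forall H : sgraph, #|H| = n -> pathwidth H <= t -> contains_subgraph U H) ->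
  n <= #|U| /\ 2 ^ (n - t - 3) <= #|U| ^ t.
Proof.
move=> t2 tn noK univ.
(* With [t - 2] clique vertices the pathwidth is at most [t], and a [K_4] model beside them would
   give [K_(t+2)]. *)
pose ds := take (t - 2) (enum 'I_n).
have szds : size ds = t - 2 by rewrite size_takel // size_enum_ord; lia.
have [a [b [r enumE]]] : exists a b r, enum 'I_n = ds ++ [:: a, b & r].
  rewrite -{1}(cat_take_drop (t - 2) (enum 'I_n)) -/ds.
  have : 2 <= size (drop (t - 2) (enum 'I_n)) by rewrite size_drop size_enum_ord; lia.
  by case: drop => [|a [|b r]] // _; exists a, b, r.
have uds : uniq (ds ++ [:: a, b & r]) by rewrite -enumE enum_uniq.
have cov x : x \in ds ++ [:: a, b & r] by rewrite -enumE mem_enum.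
(* Codes thus have length [n - t - 1]; two fixed leading bits leave [n - t - 3] free ones. *)
have szr : size r = n - t.
  by have := congr1 size enumE; rewrite size_cat szds size_enum_ord /=; lia.
have ur : uniq [:: a, b & r] by move: uds; rewrite cat_uniq => /and3P[].
have emb s : size r = (size s).+1 -> exists f : 'I_n -> U,
    [/\ injective f, pairwise (@adj U) (map f ds),
    all (mem [set v | all (adj v) (map f ds)]) (map f [:: a, b & r]) &
    ladder (@adj U) (f a) (f b) s (map f r)].
  move=> szs; apply: apex_ladder_embedding => //; apply: univ.
    by rewrite /= card_ord.
  by rewrite (leq_trans (pathwidth_apex_ladder _ _ _)) // szds; lia.
have leU : n <= #|U|.
  have [|f [f_inj _ _ _]] := emb (nseq (n - t).-1 false).
    by rewrite size_nseq szr; lia.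
  by rewrite -[X in X <= _]card_ord; apply: leq_card f_inj.
(* For [n <= t + 3] the truncated exponent is [0], and [U] is nonempty. *)
split=> //; have [lek|ltk] := leqP n (t + 3).
  by rewrite -subnDA (eqP lek) expn_gt0; lia.
pose k := n - t - 3.
have /choice[F FP] (c : k.-tuple bool) : exists f : 'I_n -> U,
    [/\ injective f, pairwise (@adj U) (map f ds),
    all (mem [set v | all (adj v) (map f ds)]) (map f [:: a, b & r]) &
    ladder (@adj U) (f a) (f b) [:: false, false & c] (map f r)].
  by apply: emb; rewrite /= size_tuple szr /k; lia.
(* The key has [t] entries: the clique images and the first and last strip vertices. *)
pose Phi c : (t - 2).-tuple U * (U * U) :=
  (map_tuple (F c) (Tuple (introT eqP szds)), (F c a, F c (last a r))).
suff /leq_card : injective Phi.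
  rewrite !card_prod !card_tuple card_bool mulnn -expnD.
  by rewrite subnK.
move=> c c' [dsE aE yE]; apply: val_inj.
have [f_inj cl aN lad] := FP c; have [f_inj' _ aN' lad'] := FP c'.
rewrite -dsE ?map_cons -aE in aN' lad'.
have uF (g : 'I_n -> U) : injective g -> uniq (map g [:: a, b & r]).
  by move=> /map_inj_uniq->.
apply: (ladder_code_unique (apex_no_K4_model cl _) (uF _ f_inj) _ aN aN' lad lad').
- by rewrite size_map szds; have -> : t - 2 + 4 = t + 2 by lia.
- by rewrite aE; apply: uF f_inj'.
- by rewrite !size_tuple.
- by rewrite {2}aE !last_map.
Qed.

Local Open Scope ring_scope.

(** Take [t]-th roots in the counting bound, whose exponent [n - t - 3] exceeds the one needed by
    [1]. *)
Theorem theorem4p6 (R : realType) (n t : nat) (U : sgraph) :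
  (2 <= t)%N -> (t < n)%N ->
  ~ is_minor (complete_graph (t + 2)) U ->
  (forall H : sgraph, #|H| = n -> (pathwidth H <= t)%N -> contains_subgraph U H) ->
  2 `^ ((n%:R - t%:R - 4) / t%:R) <= #|U|%:R :> R.
Proof.
move=> t2 tn noK univ; have [leU leUt] := universal_graph_card t2 tn noK univ.
have U1 : 1 <= #|U|%:R :> R by rewrite ler1n; lia.
have t0 : 0 < t%:R :> R by rewrite ltr0n; lia.
(* If [n <= t + 4], the exponent is nonpositive and the left side is at most [1]; otherwise real and
   truncated subtraction agree. *)
have [lek|ltk] := leqP n (t + 4).
  apply: le_trans U1; rewrite -[leRHS](powRr0 2) ler_powR ?ler1n //.
  by rewrite pmulr_lle0 ?invr_gt0 // -addrA -opprD subr_le0 -natrD ler_nat.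
have -> : n%:R - t%:R - 4 = (n - t - 4)%:R :> R by rewrite !natrB //; lia.
have -> : #|U|%:R = (#|U|%:R ^+ t) `^ (t%:R^-1) :> R.
  by rewrite -powR_mulrn // -powRrM divff ?powRr1 // lt0r_neq0.
rewrite powRrM ge0_ler_powR ?nnegrE ?invr_ge0 ?powR_ge0 ?exprn_ge0 //.
rewrite powR_mulrn // -!natrX ler_nat; apply: leq_trans leUt.
by rewrite leq_exp2l //; lia.
Qed.
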